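(* For every $\varepsilon>0$ there is $\kappa_0$ (depending only on $M$ and $\varepsilon$) such that for every space $\mathcal E$ satisfying condition (E) with $\kappa=cs\ge\kappa_0$, $$\mathsf M\left(\|u\|_\infty\right)<\left(e^{m-\frac12}+\varepsilon\right)\sqrt{\ln\kappa}.$$
   Context: Functions are real-valued. $M$ is a fixed compact connected Riemannian manifold; $G$ is a compact Lie group (possibly disconnected) acting on $M$ transitively by isometries, the action being virtually effective (its kernel is finite); $H$ is the stabilizer of a base point $o\in M$. $M=G/H$ is isotropy irreducible: $H$ has no proper nonzero invariant subspaces in $T_oM$. Put $m=\dim M$. $L^2(M)$ is taken with respect to the $G$-invariant probability measure on $M$; $\|u\|_\infty=\max_M|u|$. Condition (E) on $\mathcal E$: $\mathcal E$ is a nonzero finite dimensional $G$-invariant linear subspace of $L^2(M)$ orthogonal to the constant functions (its elements are real analytic functions, and $\dim\mathcal E>1$). $\mathcal S$ is the unit sphere of $\mathcal E$ in the $L^2(M)$ norm, $du$ is the invariant probability measure on $\mathcal S$, and $\mathsf M(f)=\int_{\mathcal S}f(u)\,du$. Further $c=\sqrt{\dim\mathcal E}$. For $p\in M$, $\phi_p\in\mathcal E$ is the element with $\langle u,\phi_p\rangle=u(p)$ for all $u\in\mathcal E$ ($L^2$ inner product; $|\phi_p|=c$), $\iota:M\to\mathcal S$, $\iota(p)=\phi_p/|\phi_p|$, and $s=s(\mathcal E)>0$ is the constant with $|d_p\iota(v)|=s|v|$ for all $p\in M$, $v\in T_pM$; equivalently $s=\sqrt{\frac{|\mathrm{Tr}(\Delta|_{\mathcal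 E})|}{m\dim\mathcal E}}$, where $\Delta$ is the Laplace–Beltrami operator on $M$ (it preserves $\mathcal E$). *)

(* Defs.v *)
From HB Require Import structures.
From mathcomp Require Import all_boot all_order all_algebra.
From mathcomp Require Import all_classical all_reals all_analysis.

Set Implicit Arguments.
Unset Strict Implicit.
Unset Printing Implicit Defensive.

Import Order.TTheory GRing.Theory Num.Theory.
Import numFieldNormedType.Exports.

Local Open Scope classical_set_scope.
Local Open Scope ring_scope.

Notation borel T := (g_sigma_algebraType (@open T)).

(* Only meaningful for an open set U. In finite dimension, f is C^k.+1 on U iff
   it is differentiable on U and all its directional derivatives are C^k. *)
Fixpoint Ck_on (R : realType) (V W : normedModType R) (k : nat) (U : set V)
    (f : V -> W) : Prop :=
  if k is k'.+1 then
    (forall x, U x -> differentiable f x) /\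
    (forall v, Ck_on k' U (fun x => 'D_v f x))
  else forall x, U x -> {for x, continuous f}.

Definition smooth_on (R : realType) (V W : normedModType R) (U : set V)
    (f : V -> W) : Prop := forall k, Ck_on k U f.

(* A chart is the triple of its domain, its coordinate map and the inverse of
   the latter; both maps are total, with arbitrary values outside the domain
   and outside its image. *)
Record chart (R : realType) (T : topologicalType) (m : nat) := Chart {
  cdom : set T;
  cmap : T -> 'rV[R]_m;
  cinv : 'rV[R]_m -> T }.

Definition cimg (R : realType) (T : topologicalType) (m : nat)
  (c : chart R T m) : set 'rV[R]_m := cmap c @` cdom c.

Definition is_chart (R : realType) (T : topologicalType) (m : nat)
    (c : chart R T m) : Prop :=
  [/\ open (cdom c), open (cimg c),
      (forall p, cdom c p -> {for p, continuous (cmap c)}),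
      (forall x, cimg c x -> {for x, continuous (cinv c)}) &
      (forall p, cdom c p -> cinv c (cmap c p) = p)].

(* f read in the charts c and c' *)
Definition loc_rep (R : realType) (T T' : topologicalType) (m m' : nat)
    (c : chart R T m) (c' : chart R T' m') (f : T -> T') :
    'rV[R]_m -> 'rV[R]_m' :=
  fun x => cmap c' (f (cinv c x)).

Record smooth_structure (R : realType) (T : topologicalType) (m : nat) :=
  SmoothStructure {
    atlas : set (chart R T m);
    sm_hausdorff : hausdorff_space T;
    sm_second_countable : @second_countable T;
    sm_chart : forall c, atlas c -> is_chart c;
    sm_cover : forall p, exists2 c, atlas c & cdom c p;
    sm_compat : forall c c', atlas c -> atlas c' ->
      smooth_on (cmap c @` (cdom c `&` cdom c')) (loc_rep c c' id) }.

Definition smooth_map2 (R : realType) (X Y Z : topologicalType) (a b e : nat)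
    (SX : smooth_structure R X a) (SY : smooth_structure R Y b)
    (SZ : smooth_structure R Z e) (F : X -> Y -> Z) : Prop :=
  continuous (fun xy : X * Y => F xy.1 xy.2) /\
  forall c1 c2 c3, atlas SX c1 -> atlas SY c2 -> atlas SZ c3 ->
    smooth_on
      [set xy : 'rV[R]_a * 'rV[R]_b | [/\ cimg c1 xy.1, cimg c2 xy.2 &
         cdom c3 (F (cinv c1 xy.1) (cinv c2 xy.2))]]
      (fun xy => cmap c3 (F (cinv c1 xy.1) (cinv c2 xy.2))).

Definition smooth_map (R : realType) (X Y : topologicalType) (a b : nat)
    (SX : smooth_structure R X a) (SY : smooth_structure R Y b)
    (f : X -> Y) : Prop :=
  continuous f /\
  forall c c', atlas SX c -> atlas SY c' ->
    smooth_on [set x | cimg c x /\ cdom c' (f (cinv c x))] (loc_rep c c' f).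

(* A tangent vector at p is given by its coordinates in 'rV_m in a chart c
   around p; coordinates in c and c' correspond by the differential of the
   change of charts. In coordinates, the differential of f at p is: *)
Definition dloc (R : realType) (T T' : topologicalType) (m m' : nat)
    (c : chart R T m) (c' : chart R T' m') (f : T -> T') (p : T)
    (v : 'rV[R]_m) : 'rV[R]_m' :=
  'd (loc_rep c c' f) (cmap c p) v.

Definition tdot_of (R : realType) (T : topologicalType) (m : nat)
    (g : chart R T m -> T -> 'M[R]_m) (c : chart R T m) (p : T)
    (v w : 'rV[R]_m) : R := (v *m g c p *m w^T) 0 0.

(* metric c p is the Gram matrix of the scalar product of T_pM in the chart c *)
Record riemannian_metric (R : realType) (M : topologicalType) (m : nat)
    (SM : smooth_structure R M m) := RiemannianMetric {
  metric : chart R M m -> M -> 'M[R]_m;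
  metric_smooth : forall c, atlas SM c ->
    smooth_on (cimg c) (fun x => metric c (cinv c x));
  metric_sym : forall c p, atlas SM c -> cdom c p ->
    (metric c p)^T = metric c p;
  metric_pos : forall c p v, atlas SM c -> cdom c p -> v != 0 ->
    0 < tdot_of metric c p v v;
  metric_compat : forall c c' p v w, atlas SM c -> atlas SM c' ->
    cdom c p -> cdom c' p ->
    tdot_of metric c' p (dloc c c' id p v) (dloc c c' id p w) =
    tdot_of metric c p v w }.

Definition tnorm (R : realType) (M : topologicalType) (m : nat)
    (SM : smooth_structure R M m) (g : riemannian_metric SM)
    (c : chart R M m) (p : M) (v : 'rV[R]_m) : R :=
  Num.sqrt (tdot_of (metric g) c p v v).

Definition is_isometry (R : realType) (M : topologicalType) (m : nat)
    (SM : smooth_structure R M m) (g : riemannian_metric SM)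
    (f : M -> M) : Prop :=
  [/\ bijective f, smooth_map SM SM f &
    forall c c' p v w, atlas SM c -> atlas SM c' ->
      cdom c p -> cdom c' (f p) ->
      tdot_of (metric g) c' (f p) (dloc c c' f p v) (dloc c c' f p w) =
      tdot_of (metric g) c p v w].

(* A group with a topology, not yet related; is_lie_group relates them. *)
#[short(type="topologicalGroupCarrierType")]
HB.structure Definition TopologicalGroupCarrier :=
  {G of Group G & Topological G}.

Definition is_lie_group (R : realType) (G : topologicalGroupCarrierType)
    (d : nat) (SG : smooth_structure R G d) : Prop :=
  smooth_map2 SG SG SG (fun x y => (x * y)%g) /\
  smooth_map SG SG (fun x => (x^-1)%g).

Definition is_action (G : groupType) (M : Type) (act : G -> M -> M) : Prop :=
  (forall p, act 1%g p = p) /\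
  (forall x y p, act (x * y)%g p = act x (act y p)).

Definition transitive_action (G : groupType) (M : Type) (act : G -> M -> M) :
  Prop := forall p q, exists x, act x p = q.

Definition virtually_effective (G : groupType) (M : Type)
  (act : G -> M -> M) : Prop := finite_set [set x | forall p, act x p = p].

Definition stabilizer (G : groupType) (M : Type) (act : G -> M -> M) (o : M) :
  set G := [set h | act h o = o].

Definition isotropy_irreducible (R : realType) (M : topologicalType) (m : nat)
    (SM : smooth_structure R M m) (G : groupType) (act : G -> M -> M) (o : M) :
    Prop :=
  forall c, atlas SM c -> cdom c o ->
  forall V : {vspace 'rV[R]_m},
    (forall h v, stabilizer act o h -> v \in V ->
       dloc c c (act h) o v \in V) ->
    V = 0%VS \/ V = fullv.

Record isotropy_irreducible_space (R : realType) (M : topologicalType)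
    (m : nat) (SM : smooth_structure R M m) (g : riemannian_metric SM)
    (G : topologicalGroupCarrierType) (d : nat) (SG : smooth_structure R G d)
    (act : G -> M -> M) (o : M) : Prop := IsotropyIrreducibleSpace {
  iis_lie : is_lie_group SG;
  iis_compact : compact [set: G];
  iis_action : is_action act;
  iis_smooth : smooth_map2 SG SM SM act;
  iis_isometry : forall x, is_isometry g (act x);
  iis_transitive : transitive_action act;
  iis_virt_eff : virtually_effective act;
  iis_irreducible : isotropy_irreducible SM act o }.

Definition invariant_measure (R : realType) (M : ptopologicalType)
    (G : Type) (act : G -> M -> M) (mu : probability (borel M) R) : Prop :=
  forall x (A : set (borel M)), measurable A -> mu (act x @^-1` A) = mu A.

Definition L2dot (R : realType) (M : ptopologicalType)
    (mu : probability (borel M) R) (u v : M -> R) : R :=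
  Rintegral mu [set: borel M] (fun p => u p * v p).

Definition L2norm (R : realType) (M : ptopologicalType)
    (mu : probability (borel M) R) (u : M -> R) : R :=
  Num.sqrt (L2dot mu u u).

Definition supnorm (R : realType) (M : Type) (u : M -> R) : R :=
  sup [set `|u p| | p in [set: M]].

Definition lincomb (R : realType) (M : Type) (n : nat) (b : 'I_n -> M -> R)
    (x : 'rV[R]_n) : M -> R := fun p => \sum_(i < n) x 0 i * b i p.

(* A finite dimensional G-invariant subspace of L^2(M) is given by the
   continuous (in fact real analytic) representatives of its elements, which
   are unique because a G-invariant measure has full support. *)
Record conditionE (R : realType) (M : ptopologicalType)
    (mu : probability (borel M) R) (G : Type) (act : G -> M -> M)
    (E : set (M -> R)) : Prop := ConditionE {
  E_continuous : forall u, E u -> continuous u;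
  E_0 : E (fun=> 0);
  E_add : forall u v, E u -> E v -> E (fun p => u p + v p);
  E_scale : forall (a : R) u, E u -> E (fun p => a * u p);
  E_fin_dim : exists (n : nat) (b : 'I_n -> M -> R),
    forall u, E u -> exists x, u = lincomb b x;
  E_nonzero : exists2 u, E u & u <> (fun=> 0);
  E_invariant : forall x u, E u -> E (fun p => u (act x p));
  E_orth_const : forall u, E u -> L2dot mu u (fun=> 1) = 0 }.

Definition orthonormal_basis (R : realType) (M : ptopologicalType)
    (mu : probability (borel M) R) (E : set (M -> R)) (n : nat)
    (b : 'I_n -> M -> R) : Prop :=
  [/\ forall i, E (b i),
      forall i j, L2dot mu (b i) (b j) = (i == j)%:R &
      forall u, E u -> exists x, u = lincomb b x].

Definition coords (R : realType) (M : ptopologicalType)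
    (mu : probability (borel M) R) (n : nat) (b : 'I_n -> M -> R)
    (u : M -> R) : 'rV[R]_n := \row_(i < n) L2dot mu u (b i).

(* The library norm on 'rV is the maximum norm. *)
Definition eucl_norm (R : realType) (n : nat) (x : 'rV[R]_n) : R :=
  Num.sqrt (\sum_(i < n) x 0 i ^+ 2).

Definition usphere (R : realType) (n : nat) : set 'rV[R]_n :=
  [set x | eucl_norm x = 1].
Arguments usphere : clear implicits.

Definition uniform_on_sphere (R : realType) (n : nat)
    (sigma : probability (borel 'rV[R]_n) R) : Prop :=
  sigma (usphere R n) = 1%E /\
  forall Q : 'M[R]_n, Q *m Q^T = 1%:M ->
  forall A : set (borel 'rV[R]_n), measurable A ->
    sigma ((fun x : 'rV[R]_n => x *m Q) @^-1` A) = sigma A.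

(* The mean over the unit sphere of E, which an orthonormal basis b of E
   identifies with the unit sphere of R^n, n = dim E; by invariance the result
   does not depend on b. *)
Definition sphere_mean (R : realType) (M : Type) (n : nat)
    (sigma : probability (borel 'rV[R]_n) R) (b : 'I_n -> M -> R)
    (F : (M -> R) -> R) : \bar R :=
  (\int[sigma]_(x in (usphere R n : set (borel 'rV[R]_n)))
     (F (lincomb b x))%:E)%E.

Definition evaluation_vectors (R : realType) (M : ptopologicalType)
    (mu : probability (borel M) R) (E : set (M -> R)) (phi : M -> M -> R) :
    Prop :=
  forall p, E (phi p) /\ forall u, E u -> L2dot mu u (phi p) = u p.

Definition iota_map (R : realType) (M : ptopologicalType)
    (mu : probability (borel M) R) (phi : M -> M -> R) (p : M) : M -> R :=
  fun q => phi p q / L2norm mu (phi p).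

(* |d_p iota(v)| = s |v|, the differential being computed in a chart of M and
   in the coordinates of E with respect to the orthonormal basis b. *)
Definition dilation_factor (R : realType) (M : ptopologicalType) (m : nat)
    (SM : smooth_structure R M m) (g : riemannian_metric SM)
    (mu : probability (borel M) R) (n : nat) (b : 'I_n -> M -> R)
    (phi : M -> M -> R) (s : R) : Prop :=
  0 < s /\
  forall c p, atlas SM c -> cdom c p ->
    let h x := coords mu b (iota_map mu phi (cinv c x)) in
    differentiable h (cmap c p) /\
    forall v, eucl_norm ('d h (cmap c p) v) = s * tnorm g c p v.

(* Main.v *)
Require Import Defs.
From HB Require Import structures.
From mathcomp Require Import all_boot all_order all_algebra.
From mathcomp Require Import finmap all_classical all_reals all_analysis.
From mathcomp Require Import measurable_realfun ring lra zify.

Set Implicit Arguments.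
Unset Strict Implicit.
Unset Printing Implicit Defensive.

Import Order.TTheory GRing.Theory Num.Theory.
Import numFieldNormedType.Exports.

Local Open Scope classical_set_scope.
Local Open Scope ring_scope.

(** An element of the unit sphere of E is u = <x, B>, with x a unit vector of
    R^n and B(p) = (b_1(p), ..., b_n(p)). Invariance and transitivity give
    |B(p)|^2 = n at every p ([basis_row_norm]). Hence iota is B / sqrt n in
    coordinates, and the dilation factor s bounds the gradient of every such u
    by kappa = sqrt n * s ([sphere_gradient_le]). So u varies by at most 1 on
    the cells of a subdivision of M of mesh comparable to 1 / kappa; C kappa^m
    cells suffice, where C depends only on M and its metric ([gradient_net]).
    The supremum of |u| is therefore at most 1 plus the maximum of |u| over
    N <= C kappa^m points.

    At a single point, the moment of order 2k of u(p) over the sphere is at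
    most k^k ([moment_bound]), and this bounds the mean of the maximum over N
    points by sqrt (e k) as soon as N <= e^k ([mean_max_le]). The condition
    holds for some k close to m ln kappa, which yields a bound close to
    sqrt (e m ln kappa). Finally e m <= e^(2m - 1) for every natural number m,
    and eps absorbs the additive 1, the constant C and the rounding of k
    ([constant_bounds]). *)

(** * Integration of continuous functions for Borel measures *)

Lemma borel_measurable_continuous (T T' : ptopologicalType) (f : T -> T') :
  continuous f ->
  measurable_fun [set: borel T] (f : borel T -> borel T').
Proof.
move=> cf.
apply: (@measurability _ _ (borel T) (borel T') setT f (@open T') erefl).
move=> _ [B oB <-]; rewrite setTI; apply: sub_sigma_algebra.
by move/continuousP : cf; apply.
Qed.

Lemma real_measurable_continuous (R : realType) (T : ptopologicalType)
    (f : T -> R) (D : set (borel T)) :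
  continuous f -> measurable_fun D (f : borel T -> R).
Proof.
move=> cf; apply: measurable_funTS.
apply: (@measurability _ _ (borel T) _ setT f _ (RGenOpens.measurableE R)).
move=> _ [B [a [b ->]] <-]; rewrite setTI; apply: sub_sigma_algebra.
by move/continuousP : cf; apply; exact: interval_open.
Qed.

Lemma borel_measurable_closed (T : ptopologicalType) (D : set T) :
  closed D -> measurable (D : set (borel T)).
Proof.
move=> cD; rewrite -(setCK D); apply: measurableC.
by apply: sub_sigma_algebra; exact: closed_openC.
Qed.

Section borel_integrals.
Variables (R : realType) (T : ptopologicalType) (mu : probability (borel T) R).
Variable D : set (borel T).
Hypothesis mD : measurable D.

Lemma continuous_integrable (f : T -> R) :
  continuous f -> (exists C : R, forall x, D x -> `|f x| <= C) ->
  mu.-integrable D (EFin \o f).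
Proof.
move=> cf [C fC]; apply: measurable_bounded_integrable => //.
- by rewrite (le_lt_trans (probability_le1 _ mD))// ltry.
- exact: real_measurable_continuous.
- exists C; split; first exact: num_real.
  by move=> M CM x Dx; apply: le_trans (fC _ Dx) _; exact: ltW.
Qed.

Lemma Rintegral_sum (I : Type) (r : seq I) (f : I -> T -> R) :
  (forall i, mu.-integrable D (EFin \o f i)) ->
  mu.-integrable D (EFin \o (fun x => \sum_(i <- r) f i x)) /\
  Rintegral mu D (fun x => \sum_(i <- r) f i x) =
    \sum_(i <- r) Rintegral mu D (f i).
Proof.
move=> intf; elim: r => [|i r [IHi IHe]].
  have E0 : (fun x : borel T => \sum_(i <- [::]) f i x) = cst 0.
    by apply/funext => x; rewrite big_nil.
  rewrite E0 big_nil Rintegral_cst// mul0r; split => //.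
  exact: integrable0.
have Ec : (fun x : borel T => \sum_(j <- i :: r) f j x) =
    (fun x => f i x + \sum_(j <- r) f j x).
  by apply/funext => x; rewrite big_cons.
rewrite Ec big_cons RintegralD// IHe; split => //.
exact: (integrableD mD (intf i) IHi).
Qed.

Lemma Rintegral_invariant (g : T -> T) (f : T -> R) :
  continuous g -> (forall A : set (borel T), measurable A ->
    mu (g @^-1` A) = mu A) -> g @^-1` D = D ->
  continuous f -> (exists C : R, forall x, D x -> `|f x| <= C) ->
  Rintegral mu D (fun x => f (g x)) = Rintegral mu D f.
Proof.
move=> cg invg gD cf [C fC].
have mg : measurable_fun [set: borel T] (g : borel T -> borel T).
  exact: borel_measurable_continuous.
have intfg : mu.-integrable (g @^-1` D) (EFin \o f \o g).
  rewrite gD; apply: (@continuous_integrable (f \o g)).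
    by move=> x; apply: continuous_comp; [exact: cg|exact: cf].
  by exists C => x Dx; apply: fC; move: Dx; rewrite -{1}gD.
rewrite /Rintegral; congr fine.
have mf := (measurable_EFinP ([set: borel T] : set (borel T))
  (f : borel T -> R)).2
  (@real_measurable_continuous R T f [set: borel T] cf).
have /= H := integral_pushforward mg mf intfg mD.
rewrite gD in H; rewrite -H.
by apply: eq_measure_integral => A mA _ /=; rewrite /pushforward; exact: invg.
Qed.

End borel_integrals.

(** * Euclidean geometry of row vectors *)

Lemma continuous_sum (R : realType) (T : topologicalType) (I : Type)
    (r : seq I) (f : I -> T -> R) :
  (forall i, continuous (f i)) -> continuous (fun x => \sum_(i <- r) f i x).
Proof.
move=> cf x; apply: cvg_big => [|i _]; last exact: cf.
by move=> z; exact: add_continuous.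
Qed.

Lemma rV_continuous (R : realType) (T : topologicalType) (n : nat)
    (f : T -> 'rV[R]_n) :
  (forall i, continuous (fun x => f x 0 i)) -> continuous f.
Proof.
move=> cf x A [P nP PA].
apply: (@filterS _ (nbhs x) _ [set y | forall i, P 0 i (f y 0 i)]).
  by move=> y /= Py; apply: PA => i j; rewrite ord1.
apply: filter_forall => i; exact: cf (nP 0 i).
Qed.

Section dot.
Variables (R : realType) (n : nat).
Implicit Types (x y a b w : 'rV[R]_n).

Definition dot x y : R := \sum_(i < n) x 0 i * y 0 i.

Lemma dot_mx x y : dot x y = (x *m y^T) 0 0.
Proof. by rewrite mxE; apply: eq_bigr => i _; rewrite mxE. Qed.

Lemma dotC x y : dot x y = dot y x.
Proof. by apply: eq_bigr => i _; rewrite mulrC. Qed.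

Lemma dotDl x y a : dot (x + y) a = dot x a + dot y a.
Proof. by rewrite -big_split; apply: eq_bigr => i _; rewrite mxE mulrDl. Qed.

Lemma dotZl c x a : dot (c *: x) a = c * dot x a.
Proof. by rewrite mulr_sumr; apply: eq_bigr => i _; rewrite mxE mulrA. Qed.

Lemma dotDr x a b : dot x (a + b) = dot x a + dot x b.
Proof. by rewrite dotC dotDl dotC (dotC b). Qed.

Lemma dotZr c x a : dot x (c *: a) = c * dot x a.
Proof. by rewrite dotC dotZl dotC. Qed.

Lemma dotBl x y a : dot (x - y) a = dot x a - dot y a.
Proof. by rewrite dotDl -scaleN1r dotZl mulN1r. Qed.

Lemma dotBr x a b : dot x (a - b) = dot x a - dot x b.
Proof. by rewrite dotC dotBl dotC (dotC b). Qed.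

Lemma dot_ge0 x : 0 <= dot x x.
Proof. by apply: sumr_ge0 => i _; rewrite -expr2 sqr_ge0. Qed.

Lemma dot_eq0 x : (dot x x == 0) = (x == 0).
Proof.
apply/eqP/eqP => [x0|->]; last by rewrite -(scale0r 0) dotZl mul0r.
apply/rowP => i; rewrite mxE; apply/eqP; rewrite -sqrf_eq0 expr2.
by have /psumr_eq0P := x0; move=> ->// j _; rewrite -expr2 sqr_ge0.
Qed.

Lemma dot_delta x i : dot x (delta_mx 0 i) = x 0 i.
Proof.
rewrite /dot (bigD1 i)//= mxE !eqxx mulr1 big1 ?addr0// => j ji.
by rewrite mxE (negbTE ji) andbF mulr0.
Qed.

Lemma eucl_norm_dot x : eucl_norm x = Num.sqrt (dot x x).
Proof. by congr Num.sqrt; apply: eq_bigr => i _; rewrite expr2. Qed.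

Lemma usphereP x : usphere R n x <-> dot x x = 1.
Proof.
rewrite /usphere /= eucl_norm_dot; split=> [x1|->]; last exact: sqrtr1.
by rewrite -(sqr_sqrtr (dot_ge0 x)) x1 expr1n.
Qed.

(** The Cauchy-Schwarz inequality for a unit vector x, read off from the
    nonnegativity of |a - <x, a> x|^2. *)
Lemma dot_usphere_le x a : usphere R n x -> `|dot x a| <= eucl_norm a.
Proof.
move=> /usphereP x1; rewrite eucl_norm_dot -sqrtr_sqr ler_wsqrtr//.
have := dot_ge0 (a - dot x a *: x).
rewrite !(dotBl, dotBr, dotZl, dotZr) x1 (dotC a x); lra.
Qed.

Lemma dot_continuous a : continuous (fun x => dot x a).
Proof.
apply: (@continuous_sum R _ _ _ (fun i x => x 0 i * a 0 i)) => i x.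
apply: (@continuousM _ _ (fun x : 'rV[R]_n => x 0 i) (cst (a 0 i))).
  exact: coord_continuous.
exact: cst_continuous.
Qed.

Lemma usphere_closed : closed (usphere R n).
Proof.
have -> : usphere R n = (fun x => dot x x) @^-1` [set 1].
  by apply/seteqP; split=> x /usphereP.
apply: (continuous_closedP _).1; last exact: closed_eq.
apply: (@continuous_sum R _ _ _ (fun i x => x 0 i * x 0 i)) => i x.
apply: (@continuousM _ _ (fun x : 'rV[R]_n => x 0 i) (fun x => x 0 i));
  exact: coord_continuous.
Qed.

(** Q is the orthogonal reflection in the hyperplane normal to a - b, which
    exchanges the unit vectors a and b. *)
Lemma reflection_exists a b : dot a a = 1 -> dot b b = 1 ->
  exists2 Q : 'M[R]_n, Q *m Q^T = 1%:M & forall x, dot (x *m Q) a = dot x b.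
Proof.
move=> a1 b1; have [->|ab] := eqVneq a b.
  by exists 1%:M => [|x]; rewrite ?trmx1 mulmx1.
have [w wE] : {w | w = a - b} by exists (a - b).
pose c := 2 / dot w w.
have w0 : dot w w != 0 by rewrite dot_eq0 wE subr_eq0.
have wT : w *m w^T = (dot w w)%:M by rewrite dot_mx -mx11_scalar.
have QT : (1%:M - c *: (w^T *m w))^T = 1%:M - c *: (w^T *m w).
  by rewrite linearB linearZ/= trmx1 trmx_mul trmxK.
have SS : w^T *m w *m (w^T *m w) = dot w w *: (w^T *m w).
  by rewrite mulmxA -(mulmxA w^T) wT mul_mx_scalar scalemxAl.
have cE : c * c * dot w w = c + c by rewrite -mulrA divfK// mulr2n mulrDr mulr1.
exists (1%:M - c *: (w^T *m w)) => [|x].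
  rewrite QT mulmxBl mul1mx mulmxBr mulmx1 -scalemxAl -scalemxAr SS !scalerA.
  by rewrite cE scalerDl opprB addrK subrK.
rewrite dot_mx -mulmxA -[X in _ *m X]trmxK trmx_mul trmxK QT -dot_mx.
congr dot.
rewrite mulmxBr mulmx1 -scalemxAr mulmxA.
have -> : a *m w^T = (dot a w)%:M by rewrite dot_mx -mx11_scalar.
rewrite mul_scalar_mx scalerA.
have -> : c * dot a w = 1.
  have E : dot w w = 2 * dot a w.
    rewrite wE !(dotBl, dotBr) a1 b1 (dotC b a); lra.
  by apply: (mulIf w0); rewrite /c mulrAC divfK// mul1r -E.
by rewrite scale1r wE subKr.
Qed.

End dot.

Lemma mulmxr_continuous (R : realType) (n : nat) (Q : 'M[R]_n) :
  continuous (fun x : 'rV[R]_n => x *m Q).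
Proof.
apply: rV_continuous => j.
have -> : (fun x : 'rV[R]_n => (x *m Q) 0 j) = (fun x => dot x (col j Q)^T).
  by apply/funext => x; rewrite mxE; apply: eq_bigr => i _; rewrite !mxE.
exact: dot_continuous.
Qed.

(** * Moments of linear forms on the sphere *)

Lemma poly_eq_horner (R : numDomainType) (p q : {poly R}) :
  (forall t, p.[t] = q.[t]) -> p = q.
Proof.
move=> pq; apply/eqP; rewrite -subr_eq0; apply/eqP.
pose rs := [seq (i%:R : R) | i <- iota 0 (size (p - q))].
apply: (@roots_geq_poly_eq0 _ _ rs).
- by apply/allP => t _; rewrite rootE hornerD hornerN pq subrr.
- rewrite map_inj_uniq ?iota_uniq// => i j /eqP.
  by rewrite eqr_nat => /eqP.
- by rewrite size_map size_iota.
Qed.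

Section sphere_moments.
Variables (R : realType) (n : nat) (sigma : probability (borel 'rV[R]_n) R).
Hypothesis sigma_uniform : uniform_on_sphere sigma.
Implicit Types (x y a b e f : 'rV[R]_n).

Local Notation mean := (Rintegral sigma (usphere R n : set (borel 'rV[R]_n))).

Let mS : measurable (usphere R n : set (borel 'rV[R]_n)).
Proof. by apply: borel_measurable_closed; exact: usphere_closed. Qed.

Lemma sphere_mean_cst c : mean (fun=> c) = c.
Proof.
rewrite Rintegral_cst// [X in fine X](_ : _ = 1%E) ?mulr1//.
exact: sigma_uniform.1.
Qed.

Lemma power_continuous a p : continuous (fun x => dot x a ^+ p).
Proof.
move=> x; apply: (@continuous_comp _ _ _ (fun x => dot x a)
  (fun t : R => t ^+ p)); first exact: dot_continuous.
exact: exprn_continuous.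
Qed.

Lemma monomial_continuous a b p q :
  continuous (fun x => dot x a ^+ p * dot x b ^+ q).
Proof.
move=> x; apply: (@continuousM _ _ (fun x => dot x a ^+ p)
  (fun x => dot x b ^+ q)); exact: power_continuous.
Qed.

Lemma monomial_bounded a b p q : exists C : R, forall x, usphere R n x ->
  `|dot x a ^+ p * dot x b ^+ q| <= C.
Proof.
exists (eucl_norm a ^+ p * eucl_norm b ^+ q) => x Sx.
rewrite normrM !normrX ler_pM ?exprn_ge0//.
  by rewrite lerXn2r ?nnegrE ?sqrtr_ge0// dot_usphere_le.
by rewrite lerXn2r ?nnegrE ?sqrtr_ge0// dot_usphere_le.
Qed.

Lemma monomial_integrable a b p q : sigma.-integrable
  (usphere R n : set (borel 'rV[R]_n))
  (EFin \o (fun x => dot x a ^+ p * dot x b ^+ q)).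
Proof.
apply: continuous_integrable; first exact: mS.
  exact: monomial_continuous.
exact: monomial_bounded.
Qed.

Definition moment p a := mean (fun x => dot x a ^+ p).

Lemma power_integrable a p : sigma.-integrable
  (usphere R n : set (borel 'rV[R]_n)) (EFin \o (fun x => dot x a ^+ p)).
Proof.
have := monomial_integrable a a p 0.
by congr (sigma.-integrable _ (EFin \o _)); apply/funext => x; rewrite mulr1.
Qed.

(** Rotation invariance: a reflection carries a to b. *)
Lemma moment_unit p a b : dot a a = 1 -> dot b b = 1 ->
  moment p a = moment p b.
Proof.
move=> a1 b1; have [Q QT Qab] := reflection_exists a1 b1.
have QQ x y : dot (x *m Q) (y *m Q) = dot x y.
  by rewrite !dot_mx trmx_mul mulmxA -(mulmxA x) QT mulmx1.
rewrite /moment; transitivity (mean (fun x => dot (x *m Q) a ^+ p)); last first.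
  by apply: eq_Rintegral => x _; rewrite Qab.
apply/esym; apply: (@Rintegral_invariant R 'rV[R]_n sigma (usphere R n) mS
  (fun x => x *m Q) (fun x => dot x a ^+ p)) => //.
- move=> x; exact: mulmxr_continuous.
- by move=> A mA; exact: sigma_uniform.2.
- apply/seteqP; split=> x /usphereP => [xQ|x1]; apply/usphereP.
    by rewrite -QQ.
  by rewrite QQ.
- exact: power_continuous.
- have [C HC] := monomial_bounded a a p 0; exists C => x /HC.
  by rewrite mulr1.
Qed.

(** Homogeneity reduces to a unit vector, up to the square root of |a|^2. *)
Lemma moment_even k a e : dot e e = 1 ->
  moment k.*2 a = dot a a ^+ k * moment k.*2 e.
Proof.
move=> e1; have [->|a0] := eqVneq a 0.
  have -> : dot (0 : 'rV[R]_n) 0 = 0 by apply/eqP; rewrite dot_eq0.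
  have E x : dot x 0 = 0 by rewrite -(scale0r 0) dotZr mul0r.
  case: k => [|k].
    rewrite mul1r /moment.
    by apply: eq_Rintegral => x _; rewrite !expr0.
  rewrite exprS !mul0r /moment -[RHS]sphere_mean_cst.
  by apply: eq_Rintegral => x _; rewrite E doubleS exprS mul0r.
have s0 : 0 < dot a a by rewrite lt_def dot_eq0 a0 dot_ge0.
pose r := Num.sqrt (dot a a).
have r0 : r != 0 by rewrite gt_eqF// sqrtr_gt0.
have rr : r ^+ 2 = dot a a by rewrite sqr_sqrtr// ltW.
have aE : a = r *: (r^-1 *: a) by rewrite scalerA mulfV// scale1r.
have a1 : dot (r^-1 *: a) (r^-1 *: a) = 1.
  by rewrite dotZl dotZr -rr; field.
rewrite -(moment_unit _ a1 e1) -rr -exprM mul2n /moment.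
rewrite -RintegralZl//; last exact: power_integrable.
by apply: eq_Rintegral => x _; rewrite [in LHS]aE dotZr exprMn.
Qed.

(** For all real t the mean of <x, e + t f>^(2k+2) is (1 + t^2)^(k+1) times
    the moment of <x, e>, because |e + t f|^2 = 1 + t^2. Both sides are
    polynomials in t, and the identity is the equality of their coefficients
    of t^2, after division by k + 1. *)
Lemma mixed_moment k e f : dot e e = 1 -> dot f f = 1 -> dot e f = 0 ->
  moment k.+1.*2 e =
  k.*2.+1%:R * mean (fun x => dot x e ^+ k.*2 * dot x f ^+ 2).
Proof.
move=> e1 f1 ef.
pose N := k.+1.*2.
pose Mix j := mean (fun x => dot x e ^+ (N - j) * dot x f ^+ j).
pose P : {poly R} := \poly_(j < N.+1) ('C(N, j)%:R * Mix j).
pose Q : {poly R} := moment N e *: (1 + 'X^2) ^+ k.+1.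
have PQ : P = Q.
  apply: poly_eq_horner => t.
  have -> : Q.[t] = moment N e * (1 + t ^+ 2) ^+ k.+1 by rewrite /Q !hornerE.
  have -> : (1 + t ^+ 2) = dot (e + t *: f) (e + t *: f).
    rewrite !(dotDl, dotDr, dotZl, dotZr) e1 f1 (dotC f) ef; ring.
  rewrite mulrC -moment_even// horner_poly.
  have -> : moment k.+1.*2 (e + t *: f) =
    mean (fun x => \sum_(j < N.+1)
      ('C(N, j)%:R * t ^+ j) * (dot x e ^+ (N - j) * dot x f ^+ j)).
    apply: eq_Rintegral => x _.
    rewrite dotDr dotZr exprDn; apply: eq_bigr => j _.
    rewrite exprMn -[in LHS]mulr_natl; ring.
  have int_j (j : 'I_N.+1) : sigma.-integrable
      (usphere R n : set (borel 'rV[R]_n))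
      (EFin \o (fun x => ('C(N, j)%:R * t ^+ j) *
        (dot x e ^+ (N - j) * dot x f ^+ j))).
    under [X in _.-integrable _ X]eq_fun do rewrite /= EFinM.
    by apply: integrableZl => //; exact: monomial_integrable.
  rewrite (Rintegral_sum mS _ int_j).2; apply: eq_bigr => j _.
  rewrite RintegralZl//; last exact: monomial_integrable.
  by rewrite mulrAC.
have : P`_2 = Q`_2 by rewrite PQ.
rewrite /P /Q coef_poly coefZ (_ : (2 < N.+1)%N = true); last first.
  by rewrite /N doubleS.
have -> : ((1 + 'X^2) ^+ k.+1 : {poly R})`_2 = k.+1%:R.
  rewrite exprDn coef_sum.
  rewrite (bigD1 (Ordinal (isT : (1 < k.+2)%N)))//= big1.
    by rewrite expr1n mul1r expr1 coefMn coefXn eqxx bin1 addr0.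
  move=> i i1; rewrite expr1n mul1r coefMn -exprM coefXn.
  case: eqP => [i2|_]; last by rewrite mul0rn.
  case/eqP: i1; apply: val_inj => /=; lia.
rewrite /Mix /N doubleS subn2 /=.
have -> : 'C(k.*2.+2, 2) = (k.+1 * k.*2.+1)%N.
  rewrite bin2 /=; lia.
rewrite natrM -mulrA mulrC => /(mulIf _) -> //; by rewrite mulrC.
Qed.

(** Obtained by multiplying <x, e_i>^(2k) by 1 = sum_j x_j^2, which holds on
    the sphere: the term j = i is the next moment, and each of the n - 1 others
    is given by [mixed_moment]. *)
Lemma moment_rec k i : (n%:R + k.*2%:R) * moment k.+1.*2 (delta_mx 0 i) =
  k.*2.+1%:R * moment k.*2 (delta_mx 0 i).
Proof.
pose e j : 'rV[R]_n := delta_mx 0 j.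
have ee j l : dot (e j) (e l) = (j == l)%:R.
  by rewrite dot_delta mxE eqxx eq_sym.
pose I j := mean (fun x => dot x (e i) ^+ k.*2 * dot x (e j) ^+ 2).
have Ii : I i = moment k.+1.*2 (e i).
  by apply: eq_Rintegral => x _; rewrite -exprD addn2 doubleS.
have Ij j : j != i -> k.*2.+1%:R * I j = moment k.+1.*2 (e i).
  by move=> ji; rewrite -(mixed_moment k)// ee ?eqxx// eq_sym (negbTE ji).
have sumI : moment k.*2 (e i) = \sum_j I j.
  rewrite -(Rintegral_sum mS _ (fun j => monomial_integrable _ _ _ _)).2.
  apply: eq_Rintegral => x /set_mem /usphereP x1; rewrite -mulr_sumr.
  rewrite (_ : \sum_j _ = 1) ?mulr1// -x1.
  by apply: eq_bigr => j _; rewrite dot_delta expr2.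
rewrite -/(e i) sumI mulr_sumr (bigD1 i)//= (eq_bigr _ Ij) Ii.
rewrite big_const iter_addr addr0 cardC1 card_ord.
have n0 : (0 < n)%N by apply: leq_ltn_trans (ltn_ord i).
have -> : n%:R = n.-1%:R + 1 :> R by rewrite natr1 prednK.
rewrite -mulr_natl -natr1; ring.
Qed.

(** By [moment_rec], n^k times the moment of order 2k is at most the product of
    the first k odd numbers, and 2k + 1 <= (k + 1)^(k + 1) / k^k by the binomial
    theorem, so this product is at most k^k. *)
Lemma moment_le k i : n%:R ^+ k * moment k.*2 (delta_mx 0 i) <= k%:R ^+ k.
Proof.
elim: k => [|k IH].
  by rewrite mul1r /moment sphere_mean_cst.
have n0 : (0 < n)%N by apply: leq_ltn_trans (ltn_ord i).
have m0 j : 0 <= moment j.*2 (delta_mx 0 i).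
  by apply: Rintegral_ge0 => x _; rewrite -muln2 exprM sqr_ge0.
apply: (@le_trans _ _ (k.*2.+1%:R * k%:R ^+ k)); last first.
  rewrite -!natrX -natrM ler_nat; case: k {IH m0} => // k.
  have : (2 * k.+1 ^ k.+1 <= k.+2 ^ k.+1)%N.
    rewrite -[k.+2]addn1 expnDn big_ord_recl big_ord_recl /=.
    rewrite /bump /= bin0 bin1 !exp1n subn0 subn1 /= !muln1 !mul1n.
    by rewrite -expnS addnA mul2n -addnn leq_addr.
  move=> bernoulli; rewrite (expnS k.+2).
  apply: leq_trans (leq_mul (leqnn _) bernoulli).
  by rewrite mulnA leq_mul2r; apply/orP; right; lia.
rewrite exprSr -mulrA (le_trans (y := n%:R ^+ k *
    ((n%:R + k.*2%:R) * moment k.+1.*2 (delta_mx 0 i))))//.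
  apply: ler_wpM2l; first by rewrite exprn_ge0.
  by apply: ler_wpM2r; [exact: m0|rewrite lerDl].
rewrite moment_rec mulrCA; apply: ler_wpM2l => //.
Qed.

Lemma moment_bound k a : dot a a = n%:R -> (0 < n)%N ->
  mean (fun x => dot x a ^+ k.*2) <= k%:R ^+ k.
Proof.
move=> an n0; pose i := Ordinal n0.
have e1 : dot (delta_mx 0 i) (delta_mx 0 i : 'rV[R]_n) = 1.
  by rewrite dot_delta mxE !eqxx.
by rewrite -/(moment k.*2 a) (moment_even _ _ e1) an moment_le.
Qed.

End sphere_moments.

(** * The mean of a maximum over a finite set *)

(** The supremum norm of u is a supremum of continuous functions of the
    coordinates of u, hence lower semicontinuous; its measurability is derived
    from that. *)
Lemma lower_semicontinuous_measurable (R : realType) (T : ptopologicalType)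
    (F : T -> R) (D : set (borel T)) :
  (forall r, open [set x | r < F x]) -> measurable_fun D (F : borel T -> R).
Proof.
move=> oF; apply: measurable_funTS.
apply: (@measurability _ _ (borel T) _ setT F _ (RGenOInfty.measurableE R)).
move=> _ [B [r ->] <-]; rewrite setTI; apply: sub_sigma_algebra.
rewrite [X in open X](_ : _ = [set x | r < F x])//.
by apply/seteqP; split=> x /=; rewrite in_itv/= andbT.
Qed.

(** The tangent at 1 of the convex function y^p lies below its graph. *)
Lemma le_power_tangent (R : realType) (y : R) (p : nat) :
  0 <= y -> (0 < p)%N -> y <= 1 + (y ^+ p - 1) / p%:R.
Proof.
move=> y0 p0; have p0' : 0 < p%:R :> R by rewrite ltr0n.
have H : 1 + p%:R * (y - 1) <= y ^+ p.
  elim: p {p0 p0'} => [|p IH]; first by rewrite mul0r addr0.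
  apply: (@le_trans _ _ (y * (1 + p%:R * (y - 1)))); last first.
    by rewrite exprS ler_wpM2l.
  have : 0 <= p%:R * (y - 1) ^+ 2 by rewrite mulr_ge0 ?sqr_ge0.
  rewrite -natr1; nra.
rewrite -lerBlDl ler_pdivlMr//; lra.
Qed.

(** With A = sqrt (e k), [le_power_tangent] at y = |<x, a_j>| / A bounds F by
    1 + A + A ((sum_j (<x, a_j> / A)^(2k)) - 1) / (2k). The mean of the sum is
    at most N k^k / (e k)^k <= 1 for N = #|J|, so the last term has nonpositive
    mean: this is the inequality between the means of orders 1 and 2k, and it
    is why k is tied to N by N <= e^k. *)
Lemma mean_max_le (R : realType) (n : nat)
    (sigma : probability (borel 'rV[R]_n) R) (J : finType)
    (a : J -> 'rV[R]_n) (F : 'rV[R]_n -> R) (k : nat) :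
  uniform_on_sphere sigma -> (0 < n)%N -> (0 < k)%N ->
  (forall j, dot (a j) (a j) = n%:R) -> #|J|%:R <= expR (k%:R : R) ->
  (forall r, open [set x | r < F x]) -> (forall x, 0 <= F x) ->
  (forall x, usphere R n x -> exists j, F x <= 1 + `|dot x (a j)|) ->
  (\int[sigma]_(x in (usphere R n : set (borel 'rV[R]_n))) (F x)%:E <=
    (1 + Num.sqrt (expR 1 * k%:R))%:E)%E.
Proof.
move=> sigmaU n0 k0 an Jk oF F0 Fa.
pose D : set (borel 'rV[R]_n) := usphere R n.
have mD : measurable D.
  by apply: borel_measurable_closed; exact: usphere_closed.
have k0' : 0 < k%:R :> R by rewrite ltr0n.
set A := Num.sqrt _.
have A0 : 0 < A by rewrite sqrtr_gt0 mulr_gt0// expR_gt0.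
have AE : A ^+ k.*2 = expR k%:R * k%:R ^+ k.
  rewrite -mul2n exprM sqr_sqrtr ?mulr_ge0 ?expR_ge0 ?ltW//.
  by rewrite exprMn -expRM_natl mulr1.
have AP : 0 < A ^+ k.*2 by rewrite exprn_gt0.
pose c := A / k.*2%:R / A ^+ k.*2.
have c0 : 0 <= c by rewrite !mulr_ge0// ?invr_ge0// ltW.
pose S x : R := \sum_j dot x (a j) ^+ k.*2.
pose g x : R := (1 + A - A / k.*2%:R) + c * S x.
have intj j : sigma.-integrable D (EFin \o (fun x => dot x (a j) ^+ k.*2)).
  exact: power_integrable.
have [intS SE] := Rintegral_sum mD (index_enum J) intj.
have intcS : sigma.-integrable D (EFin \o (fun x => c * S x)).
  under [X in _.-integrable _ X]eq_fun do rewrite /= EFinM.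
  exact: integrableZl.
have intc (r : R) : sigma.-integrable D (EFin \o (fun=> r)).
  apply: continuous_integrable => //; first by move=> x; exact: cst_continuous.
  by exists `|r|.
have intg : sigma.-integrable D (EFin \o g).
  by apply: (integrableD mD (intc _) intcS).
have Fg x : D x -> F x <= g x.
  move=> Dx; have [j Fj] := Fa x Dx; apply: (le_trans Fj).
  pose y := `|dot x (a j)| / A.
  have yE : `|dot x (a j)| = A * y by rewrite /y mulrC divfK// gt_eqF.
  have y0 : 0 <= y by rewrite divr_ge0// ltW.
  have kk0 : (0 < k.*2)%N by rewrite double_gt0.
  have /(ler_wpM2l (ltW A0)) := le_power_tangent y0 kk0.
  rewrite -yE => /(lerD (lexx 1)) /le_trans; apply.
  have SjS : dot x (a j) ^+ k.*2 <= S x.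
    rewrite /S (bigD1 j)//= lerDl sumr_ge0// => i _.
    by rewrite -muln2 exprM sqr_ge0.
  have ykE : y ^+ k.*2 = dot x (a j) ^+ k.*2 / A ^+ k.*2.
    rewrite /y exprMn exprVn; congr (_ / _).
    by rewrite -normrX ger0_norm// -muln2 exprM sqr_ge0.
  have := ler_wpM2l c0 SjS; rewrite /g ykE /c; set z := dot x (a j) ^+ _ => H.
  apply: le_trans (lerD (lexx _) H).
  rewrite le_eqVlt; apply/orP; left; apply/eqP; field.
  by rewrite !gt_eqF// ltr0n.
have -> : (1 + A = (1 + A - A / k.*2%:R) + c * (A ^+ k.*2))%R.
  by rewrite /c divfK ?gt_eqF// subrK.
apply: (@le_trans _ _ (\int[sigma]_(x in D) (g x)%:E)%E).
  apply: ge0_le_integral => //.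
  - by move=> x _; rewrite lee_fin.
  - by apply/measurable_EFinP; exact: lower_semicontinuous_measurable.
  - by case/integrableP : intg.
rewrite -[leLHS]fineK; last exact: integrable_fin_num.
rewrite lee_fin -/(Rintegral sigma D g) RintegralD//.
rewrite sphere_mean_cst// lerD2l RintegralZl// ler_wpM2l// SE AE.
apply: (@le_trans _ _ (\sum_(j : J) k%:R ^+ k)).
  by apply: ler_sum => j _; exact: moment_bound.
by rewrite sumr_const -[leLHS]mulr_natl ler_wpM2r// exprn_ge0.
Qed.

(** * Nets for functions of bounded gradient *)

Lemma mx_entry_le (R : realType) (p q : nat) (A : 'M[R]_(p, q)) i j :
  `|A i j| <= `|A|.
Proof.
rewrite [leRHS]mx_normrE.
exact: (le_bigmax _ (fun ij : 'I_p * 'I_q => `|A ij.1 ij.2|) (i, j)).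
Qed.

Lemma mx_norm_le (R : realType) (p q : nat) (A : 'M[R]_(p, q)) (c : R) :
  0 <= c -> (forall i j, `|A i j| <= c) -> `|A| <= c.
Proof.
by move=> c0 Ac; rewrite [leLHS]mx_normrE; apply: bigmax_le => // -[].
Qed.

Lemma tdot_bound (R : realType) (m : nat) (G : 'M[R]_m) (v : 'rV[R]_m) :
  (v *m G *m v^T) 0 0 <= m%:R ^+ 2 * `|G| * `|v| ^+ 2.
Proof.
rewrite mxE; apply: (@le_trans _ _ (\sum_(j < m) (m%:R * `|G| * `|v| ^+ 2))).
  apply: ler_sum => j _; rewrite !mxE mulr_suml.
  apply: (@le_trans _ _ (\sum_(i < m) (`|G| * `|v| ^+ 2))).
    apply: ler_sum => i _; apply: (le_trans (ler_norm _)).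
    rewrite !normrM expr2 mulrA (mulrC `|G|).
    apply: ler_pM; rewrite ?mulr_ge0 ?mx_entry_le//.
    by apply: ler_pM; rewrite ?mx_entry_le.
  by rewrite sumr_const card_ord -[leLHS]mulr_natl mulrA.
by rewrite sumr_const card_ord -[leLHS]mulr_natl expr2 !mulrA.
Qed.

(** The mean value theorem on a segment, which stays in the ball. *)
Lemma lipschitz_ball (R : realType) (V : normedModType R) (f : V -> R)
    (x0 : V) (r L : R) :
  (forall z, ball x0 r z -> differentiable f z /\
    forall v, `|'d f z v| <= L * `|v|) ->
  forall x y, ball x0 r x -> ball x0 r y -> `|f x - f y| <= L * `|x - y|.
Proof.
move=> df x y bx by_.
pose w := x - y.
pose path (t : R) : V := y + t *: w.
have bpath (t : R) : t \in `[0, 1] -> ball x0 r (path t).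
  rewrite in_itv/= => /andP[t0 t1]; move: bx by_.
  rewrite -!ball_normE/= => bx by_.
  have -> : x0 - path t = t *: (x0 - x) + (1 - t) *: (x0 - y).
    have wE : x0 - x - (x0 - y) = - w by rewrite opprB addrC addrA subrK opprB.
    by rewrite scalerBl scale1r addrCA -scalerBr wE scalerN /path opprD addrA.
  apply: (le_lt_trans (ler_normD _ _)).
  rewrite !normrZ (ger0_norm t0) (@ger0_norm _ (1 - t)) ?subr_ge0//.
  have [->|tn0] := eqVneq t 0; first by rewrite mul0r add0r subr0 mul1r.
  have tpos : 0 < t by rewrite lt_def tn0.
  have H1 : t * `|x0 - x| < t * r by rewrite ltr_pM2l.
  have H2 : (1 - t) * `|x0 - y| <= (1 - t) * r.
    by rewrite ler_wpM2l ?subr_ge0// ltW.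
  by have := ltr_leD H1 H2; rewrite -mulrDl subrKC mul1r.
have [D DE] : exists D : R -> R, forall t, D t = 'd f (path t) w.
  by exists (fun t => 'd f (path t) w).
have dphi (t : R) : t \in `[0, 1] -> is_derive t 1 (f \o path) (D t).
  move=> t01; have [dft _] := df _ (bpath t t01).
  have E : (fun h : R =>
      h^-1 *: (((f \o path) \o shift t) (h *: 1) - (f \o path) t))
      = (fun h => h^-1 *: ((f \o shift (path t)) (h *: w) - f (path t))).
    apply/funext => h /=; congr (_ *: (f _ - _)).
    rewrite /path /= scalerDl addrCA; congr (_ *: _ + _).
    exact: mulr1.
  apply: DeriveDef.
    rewrite /derivable E; exact: (diff_derivable dft).
  by rewrite DE -deriveE// /derive E.
have cphi : {within `[0, 1], continuous (f \o path)}.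
  apply: derivable_within_continuous => t t01.
  by have [] := dphi t t01.
have dphi' (t : R) : t \in `]0, 1[ -> is_derive t 1 (f \o path) (D t).
  by move=> t01; apply: dphi; apply: subset_itv_oo_cc t01.
have [t t01] := MVT_segment ler01 dphi' cphi.
rewrite /= /path scale1r scale0r addr0 subrKC subr0 mulr1 => ->; rewrite DE.
exact: (df _ (bpath t t01)).2.
Qed.

Section net.
Variables (R : realType) (m : nat) (M : ptopologicalType).
Variables (SM : smooth_structure R M m) (g : riemannian_metric SM).

(** The norm of the differential of u is at most kappa, for the norm dual to
    the Riemannian one, in every chart. *)
Definition gradient_le (kappa : R) (u : M -> R) : Prop :=
  forall c p, atlas SM c -> cdom c p ->
    differentiable (fun x => u (cinv c x)) (cmap c p) /\
    forall v, `|'d (fun x => u (cinv c x)) (cmap c p) v| <=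
      kappa * tnorm g c p v.

(** Near a point, the Riemannian norm read in a chart is dominated by the
    maximum norm of the coordinates, since the Gram matrix is continuous. *)
Lemma metric_bounded_ball (p : M) : exists d : chart R M m * R * R,
  let: (c, r, K) := d in
  [/\ atlas SM c, cdom c p, 0 < r, 0 < K &
   forall x, ball (cmap c p) r x ->
     cimg c x /\ forall v, tnorm g c (cinv c x) v <= K * `|v|].
Proof.
have [c ac cp] := sm_cover SM p.
have [_ oi _ _ _] := sm_chart ac.
have ip : cimg c (cmap c p) by exists p.
pose G x := metric g c (cinv c x).
have cG : {for cmap c p, continuous G}.
  by have /= sm := @metric_smooth _ _ _ _ g c ac 0%N; exact: sm ip.
have /cvgrPdist_lt/(_ _ ltr01) Gnear := cG.
have : \forall x \near cmap c p, cimg c x /\ `|G x| < `|G (cmap c p)| + 1.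
  near=> x; split.
    by near: x; exact: open_nbhs_nbhs.
  have : `|G (cmap c p) - G x| < 1 by near: x; exact: Gnear.
  move=> H1; rewrite -ltrBlDl; apply: le_lt_trans H1.
  by rewrite distrC lerB_dist.
move=> /nbhs_ballP[r r0 rG].
pose B := `|G (cmap c p)| + 1.
exists (c, r, Num.sqrt (m%:R ^+ 2 * B) + 1); split => //.
move=> x /rG[ix Gx]; split=> // v.
apply: (@le_trans _ _ (Num.sqrt (m%:R ^+ 2 * B) * `|v|)); last first.
  by rewrite ler_wpM2r// lerDl.
rewrite -(ger0_norm (normr_ge0 v)) -sqrtr_sqr -sqrtrM; last first.
  by rewrite !mulr_ge0 ?exprn_ge0 ?addr_ge0.
rewrite /tnorm ler_wsqrtr// /tdot_of; apply: (le_trans (tdot_bound _ _)).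
by rewrite ler_wpM2r ?exprn_ge0// ler_wpM2l ?exprn_ge0// ltW.
Unshelve. all: by end_near. Qed.

Lemma gradient_le_oscillation (kappa : R) (u : M -> R) (c : chart R M m)
    (x0 : 'rV[R]_m) (r K : R) : atlas SM c -> 0 <= kappa ->
  (forall x, ball x0 r x ->
     cimg c x /\ forall v, tnorm g c (cinv c x) v <= K * `|v|) ->
  gradient_le kappa u ->
  forall p q, cdom c p -> cdom c q ->
    ball x0 r (cmap c p) -> ball x0 r (cmap c q) ->
    `|u p - u q| <= kappa * K * `|cmap c p - cmap c q|.
Proof.
move=> ac k0 cK du p q cp cq bp bq.
have [_ _ _ _ inv] := sm_chart ac.
rewrite -{1}(inv p cp) -{1}(inv q cq).
apply: (@lipschitz_ball R _ (fun x => u (cinv c x)) x0 r) bp bq => z bz.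
have [[p' cp' <-{z bz}] zK] := cK z bz.
have [d1 d2] := du c p' ac cp'; split=> // v.
apply: (le_trans (d2 v)); rewrite -mulrA ler_wpM2l//.
by rewrite -{1}(inv p' cp').
Qed.

(** Index of the cell of the regular subdivision of the cube of centre x0 and
    half side r into (T+1)^m cells. *)
Definition grid_cell (T : nat) (x0 : 'rV[R]_m) (r : R) (x : 'rV[R]_m) :
    {ffun 'I_m -> 'I_T.+1} :=
  [ffun i => inord (Num.truncn ((x 0 i - x0 0 i + r) / (2 * r) * T.+1%:R))].

Lemma grid_cell_dist (T : nat) (x0 x y : 'rV[R]_m) (r : R) : 0 < r ->
  ball x0 r x -> ball x0 r y -> grid_cell T x0 r x = grid_cell T x0 r y ->
  `|x - y| <= 2 * r / T.+1%:R.
Proof.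
move=> r0 bx bz /ffunP cell_eq.
have T0 : 0 < T.+1%:R :> R by rewrite ltr0n.
have coord (z : 'rV[R]_m) i : ball x0 r z ->
    let t := (z 0 i - x0 0 i + r) / (2 * r) * T.+1%:R in
    t = (inord (Num.truncn t) : 'I_T.+1)%:R + (t - (Num.truncn t)%:R) /\
    0 <= t - (Num.truncn t)%:R < 1.
  rewrite -ball_normE /= => bz'; set t := _ * _.
  have : `|x0 0 i - z 0 i| < r.
    by apply: le_lt_trans bz'; have := mx_entry_le (x0 - z) 0 i; rewrite !mxE.
  rewrite ltr_norml => /andP[z1 z2].
  have t0 : 0 <= t.
    by apply: mulr_ge0; [apply: divr_ge0; lra|exact: ltW].
  have tT : t < T.+1%:R.
    rewrite -[ltRHS]mul1r ltr_pM2r// ltr_pdivrMr; lra.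
  have /andP[t1 t2] := truncn_itv t0.
  rewrite inordK; last by rewrite truncn_lt_nat.
  by rewrite addrC subrK subr_ge0 t1 ltrBlDl natr1.
apply: mx_norm_le => [|i0 i]; first by rewrite divr_ge0 ?mulr_ge0 ?ltW.
rewrite {i0}ord1 !mxE.
have := cell_eq i; rewrite !ffunE => ci.
have /= [xE /andP[x1 x2]] := coord x i bx.
have /= [yE /andP[y1 y2]] := coord y i bz.
move: xE yE x1 x2 y1 y2; rewrite ci.
set s := (x 0 i - _ + _) / _ * _; set t := (y 0 i - _ + _) / _ * _.
move=> xE yE x1 x2 y1 y2.
have st : `|s - t| <= 1 by rewrite ler_norml; apply/andP; split; lra.
have -> : x 0 i - y 0 i = (s - t) * (2 * r / T.+1%:R).
  by rewrite /s /t; field; rewrite !gt_eqF.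
rewrite normrM (ger0_norm (_ : 0 <= 2 * r / _)) ?ler_piMl//.
all: by rewrite divr_ge0 ?mulr_ge0 ?ltW.
Qed.

(** Compactness leaves finitely many coordinate balls as in
    [metric_bounded_ball]. The T + 1 subdivisions of each side of the cube
    around each ball, T + 1 > kappa B, make a Lipschitz function with constant
    kappa K oscillate by at most 1 on each cell. The points of the net are
    chosen in the nonempty cells. *)
Lemma gradient_net : compact [set: M] -> exists2 C : R, 0 <= C &
  forall kappa, 1 <= kappa -> exists (J : finType) (P : J -> M),
    #|J|%:R <= C * kappa ^+ m /\
    forall u, gradient_le kappa u -> forall q, exists j, `|u q - u (P j)| <= 1.
Proof.
move=> Mcompact.
have [data dataP] := choice metric_bounded_ball.
pose ch p := (data p).1.1; pose r p := (data p).1.2; pose K p := (data p).2.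
have {}dataP p : [/\ atlas SM (ch p), cdom (ch p) p, 0 < r p, 0 < K p &
   forall x, ball (cmap (ch p) p) (r p) x -> cimg (ch p) x /\
     forall v, tnorm g (ch p) (cinv (ch p) x) v <= K p * `|v|].
  by have := dataP p; rewrite /ch /r /K; case: (data p) => [[]].
pose U p := [set q | cdom (ch p) q /\
  ball (cmap (ch p) p) (r p) (cmap (ch p) q)].
have Uopen p : open (U p).
  have [ac cp _ _ _] := dataP p; have [od _ cc _ _] := sm_chart ac.
  rewrite openE => q [cq bq]; apply: filterI.
    exact: open_nbhs_nbhs.
  by apply: (cc q cq); apply: open_nbhs_nbhs; split => //; exact: ball_open.
have Ucover : [set: M] `<=` cover [set: M] U.
  move=> q _; exists q => //; have [_ cq rq _ _] := dataP q.
  by split => //; exact: ballxx.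
move: Mcompact; rewrite compact_cover => /(_ _ _ U (fun p _ => Uopen p) Ucover).
move=> [D _ Dcover].
(* a sum instead of a maximum, as it dominates each 2 r K *)
pose B := \sum_(p : D) 2 * r (val p) * K (val p).
have B0 : 0 <= B.
  apply: sumr_ge0 => p _; have [_ _ r0 K0 _] := dataP (val p).
  by rewrite !mulr_ge0 ?ltW.
(* kappa B + 1 <= kappa (B + 1), as kappa >= 1 *)
exists (#|{: D}|%:R * (B + 1) ^+ m) => [|kappa k1].
  by rewrite mulr_ge0// exprn_ge0// addr_ge0.
have k0 : 0 <= kappa by rewrite (le_trans _ k1).
pose T := Num.truncn (kappa * B).
have /andP[T1 T2] := truncn_itv (mulr_ge0 k0 B0).
pose cell (p : D) q := grid_cell T (cmap (ch (val p)) (val p)) (r (val p))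
  (cmap (ch (val p)) q).
exists (D * {ffun 'I_m -> 'I_T.+1})%type,
  (fun j => xget point [set q | U (val j.1) q /\ cell j.1 q = j.2]).
split.
  rewrite card_prod card_ffun !card_ord natrM natrX -mulrA ler_wpM2l// -exprMn.
  rewrite lerXn2r ?nnegrE ?mulr_ge0 ?addr_ge0// -natr1 mulrDl mul1r lerD//.
  by rewrite mulrC.
move=> u du q; have [p /= pD Uq] := Dcover q I.
pose p' : D := [` pD]%fset.
exists (p', cell p' q).
case: xgetP => [q' _ [/= Uq' cellq']|/(_ q)]; last by case.
have [ac cp r0 K0 pK] := dataP p.
have osc := gradient_le_oscillation ac k0 pK du Uq.1 Uq'.1 Uq.2 Uq'.2.
apply: (le_trans osc).
have dist := grid_cell_dist r0 Uq.2 Uq'.2 (esym cellq').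
apply: (@le_trans _ _ (kappa * K p * (2 * r p / T.+1%:R))).
  by rewrite ler_wpM2l// mulr_ge0// ltW.
rewrite mulrA ler_pdivrMr ?ltr0n// mul1r (le_trans _ (ltW T2))//.
rewrite -mulrA ler_wpM2l// mulrC /B (bigD1 p')//= lerDl sumr_ge0// => p1 _.
by have [_ _ r1 K1 _] := dataP (val p1); rewrite !mulr_ge0 ?ltW.
Qed.

End net.

(** * The evaluation kernel of an invariant space *)

Lemma compact_bounded_function (R : realType) (T : topologicalType)
    (f : T -> R) :
  compact [set: T] -> continuous f -> exists C : R, forall x, `|f x| <= C.
Proof.
move=> cT cf.
have : compact (f @` [set: T]).
  by apply: continuous_compact => //; exact: continuous_subspaceT.
move=> /compact_bounded[C [_ HC]]; exists (C + 1) => x.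
by apply: (HC (C + 1)); [rewrite ltrDl|exists x].
Qed.

(** The form z |-> <z, x>, as a function of z that carries a linear structure
    and so has a differential. *)
Definition dotr (R : realType) (n : nat) (x z : 'rV[R]_n) : R := dot z x.

HB.instance Definition _ (R : realType) (n : nat) (x : 'rV[R]_n) :=
  GRing.isLinear.Build R 'rV[R]_n R _ (dotr x)
    (fun a u v => etrans (dotDl (a *: u) v x)
      (congr1 (fun t => t + dot v x) (dotZl a u x))).

Section invariant_space.
Variables (R : realType) (m : nat) (M : ptopologicalType).
Variables (SM : smooth_structure R M m) (g : riemannian_metric SM).
Hypothesis Mcompact : compact [set: M].
Variables (G : groupType) (act : G -> M -> M).
Hypothesis actP : is_action act.
Hypothesis act_cont : forall x, continuous (act x).
Hypothesis act_trans : transitive_action act.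
Variable mu : probability (borel M) R.
Hypothesis mu_inv : invariant_measure act mu.
Variables (E : set (M -> R)) (n : nat) (b : 'I_n -> M -> R).
Variable phi : M -> M -> R.
Hypothesis EE : conditionE mu act E.
Hypothesis bE : orthonormal_basis mu E b.
Hypothesis phiE : evaluation_vectors mu E phi.

Definition basis_row (p : M) : 'rV[R]_n := \row_i b i p.

Lemma lincomb_dot x p : lincomb b x p = dot x (basis_row p).
Proof. by apply: eq_bigr => i _; rewrite mxE. Qed.

Let E_integrable u v : E u -> E v ->
  mu.-integrable [set: borel M] (EFin \o (fun p => u p * v p)).
Proof.
move=> Eu Ev; have cu := E_continuous EE Eu; have cv := E_continuous EE Ev.
have cuv : continuous (fun p => u p * v p).
  by move=> p; apply: continuousM; [exact: cu|exact: cv].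
have [C HC] := compact_bounded_function Mcompact cuv.
apply: (@continuous_integrable R M mu [set: M] measurableT _ cuv).
by exists C => p _.
Qed.

Lemma L2dotC u v : L2dot mu u v = L2dot mu v u.
Proof. by apply: eq_Rintegral => p _; rewrite mulrC. Qed.

Lemma phi_kernel p q : phi p q = dot (basis_row p) (basis_row q).
Proof.
have [Eb bort bspan] := bE; have [Ephi phiev] := phiE p.
have [x phix] := bspan _ Ephi.
suff -> : basis_row p = x by rewrite -lincomb_dot -phix.
apply/rowP => j; rewrite mxE -(phiev _ (Eb j)) L2dotC phix /L2dot.
transitivity (Rintegral mu [set: borel M]
    (fun p => \sum_i x 0 i * (b i p * b j p))).
  apply: eq_Rintegral => r _; rewrite /lincomb mulr_suml.
  by apply: eq_bigr => i _; rewrite mulrA.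
have int_i i : mu.-integrable [set: borel M]
    (EFin \o (fun p => x 0 i * (b i p * b j p))).
  under [X in _.-integrable _ X]eq_fun do rewrite /= EFinM.
  by apply: integrableZl => //; exact: E_integrable.
rewrite (Rintegral_sum measurableT _ int_i).2 (bigD1 j)//= big1 => [|i ij].
  rewrite RintegralZl//; last exact: E_integrable.
  by rewrite -/(L2dot _ _ _) bort eqxx mulr1 addr0.
rewrite RintegralZl//; last exact: E_integrable.
by rewrite -/(L2dot _ _ _) bort (negbTE ij) mulr0.
Qed.

(** w(r) = phi (x p) (x r) belongs to E, hence w(q) = <w, phi_q>. Moving the
    action of x to the other factor, by invariance of mu, turns this product
    into the value at x p of phi_q o x^-1, which is phi_q(p). *)
Lemma phi_invariant x p q : phi (act x p) (act x q) = phi p q.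
Proof.
have [act1 actM] := actP.
have sym r r' : phi r r' = phi r' r by rewrite !phi_kernel dotC.
have [Ep Pp] := phiE (act x p); have [Eq Pq] := phiE q.
pose w r := phi (act x p) (act x r).
have Ew : E w by exact: (E_invariant EE x Ep).
rewrite -/(w q) -Pq// L2dotC.
have E1 : E (fun r => phi q (act (x^-1)%g r)) by exact: (E_invariant EE _ Eq).
have -> : L2dot mu (phi q) w =
    L2dot mu (fun r => phi q (act (x^-1)%g r)) (phi (act x p)).
  have cf : continuous (fun r => phi q r * w r).
    move=> r; apply: continuousM; first exact: (E_continuous EE Eq).
    exact: (E_continuous EE Ew).
  have [C HC] := compact_bounded_function Mcompact cf.
  rewrite /L2dot.
  rewrite -(@Rintegral_invariant R M mu [set: M] measurableT (act (x^-1)%g) _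
    (@act_cont (x^-1)%g) (@mu_inv (x^-1)%g) _ cf); last 2 first.
  - by rewrite preimage_setT.
  - by exists C => r _.
  by apply: eq_Rintegral => r _; rewrite /w -actM mulgV act1.
by rewrite Pp// -actM mulVg act1 sym.
Qed.

(** p |-> phi p p is constant by [phi_invariant] and transitivity, and its
    integral is the sum of the squared norms of the n functions b_i. *)
Lemma basis_row_norm p : dot (basis_row p) (basis_row p) = n%:R.
Proof.
have [Eb bort _] := bE.
have cst_phi q : phi q q = phi p p.
  by have [x <-] := act_trans p q; rewrite phi_invariant.
rewrite -phi_kernel.
have <- : Rintegral mu [set: borel M] (fun=> phi p p) = phi p p.
  rewrite Rintegral_cst// [X in fine X](_ : _ = 1%E) ?mulr1//.
  exact: probability_setT.
transitivity (Rintegral mu [set: borel M] (fun q => \sum_i b i q * b i q)).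
  apply: eq_Rintegral => q _; rewrite -(cst_phi q) phi_kernel.
  by apply: eq_bigr => i _; rewrite mxE.
rewrite (Rintegral_sum measurableT _ (fun i => E_integrable (Eb i) (Eb i))).2.
rewrite (eq_bigr (fun=> 1)) => [|i _].
  by rewrite sumr_const card_ord.
by rewrite -/(L2dot _ _ _) bort eqxx.
Qed.

Lemma coords_iota p :
  coords mu b (iota_map mu phi p) = (Num.sqrt n%:R)^-1 *: basis_row p.
Proof.
have [Eb _ _] := bE; have [Ep phiev] := phiE p.
have nE : L2norm mu (phi p) = Num.sqrt n%:R.
  by rewrite /L2norm phiev// phi_kernel basis_row_norm.
apply/rowP => i; rewrite !mxE /iota_map nE -phiev// L2dotC /L2dot.
rewrite -RintegralZl//; last exact: E_integrable.
by apply: eq_Rintegral => q _; rewrite mulrA mulrC.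
Qed.

(** lincomb b x is the linear form <., sqrt n x> composed with iota. *)
Lemma sphere_gradient_le s x : (0 < n)%N -> dilation_factor g mu b phi s ->
  usphere R n x -> gradient_le g (Num.sqrt n%:R * s) (lincomb b x).
Proof.
move=> n0 [s0 dil] Sx c p ac cp; have [dh dhn] := dil c p ac cp.
set h := (X in differentiable X _) in dh dhn.
set rn := Num.sqrt n%:R.
have rn0 : 0 < rn by rewrite sqrtr_gt0 ltr0n.
pose l := dotr (rn *: x).
have uE : (fun y => lincomb b x (cinv c y)) = l \o h.
  apply/funext => y /=; rewrite /l /dotr /h coords_iota lincomb_dot.
  by rewrite dotZl dotZr mulrA mulVf ?gt_eqF// mul1r dotC.
have cl : continuous l by exact: dot_continuous.
have dl y : differentiable l y by exact: linear_differentiable.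
rewrite uE; split=> [|v]; first exact: differentiable_comp.
rewrite diff_comp//= diff_lin//= /l /dotr dotZr dotC.
rewrite normrM gtr0_norm// -mulrA ler_wpM2l ?(ltW rn0)//.
by rewrite -dhn; exact: dot_usphere_le.
Qed.

Let lincomb_bounded x : has_ubound [set `|lincomb b x p| | p in [set: M]].
Proof.
have [Eb _ _] := bE.
have cu : continuous (lincomb b x).
  apply: (@continuous_sum R _ _ _ (fun i p => x 0 i * b i p)) => i p.
  apply: (@continuousM _ _ (cst (x 0 i)) (b i)); first exact: cst_continuous.
  exact: (E_continuous EE (Eb i)).
have [C HC] := compact_bounded_function Mcompact cu.
by exists C => _ [p _ <-].
Qed.

Let supnorm_ub x p : `|lincomb b x p| <= supnorm (lincomb b x).
Proof. by apply: ub_le_sup; [exact: lincomb_bounded|exists p]. Qed.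

Lemma supnorm_ge0 x : 0 <= supnorm (lincomb b x).
Proof. exact: le_trans (normr_ge0 _) (supnorm_ub x point). Qed.

Lemma supnorm_le x C : (forall p, `|lincomb b x p| <= C) ->
  supnorm (lincomb b x) <= C.
Proof.
move=> HC; apply: ge_sup; first by exists `|lincomb b x point|, point.
by move=> _ [p _ <-].
Qed.

Lemma supnorm_lower_semicontinuous r :
  open [set x | r < supnorm (lincomb b x)].
Proof.
have -> : [set x | r < supnorm (lincomb b x)] =
    \bigcup_p [set x | r < `|dot x (basis_row p)|].
  apply/seteqP; split => x /=.
    case/sup_gt; first by exists `|lincomb b x point|, point.
    by move=> _ [p _ <-] rp; exists p => //=; rewrite -lincomb_dot.
  by case=> p _ /=; rewrite -lincomb_dot => /lt_le_trans; apply.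
apply: bigcup_open => p _.
have cd : continuous (fun x => `|dot x (basis_row p)|).
  move=> x; apply: (@continuous_comp _ _ _ (fun x => dot x (basis_row p))
    (fun t : R => `|t|)); first exact: dot_continuous.
  exact: norm_continuous.
by move/continuousP : cd => /(_ _ (@open_gt R r)).
Qed.

End invariant_space.

(** * The final estimate *)

(** k is the integer part of (m + eta) ln kappa, plus 1. The margin eta ln kappa
    pays once for C and once for the rounding, and eta is such that
    2 e eta = (eps / 2)^2; the remaining eps / 2 pays for the additive 1. *)
Lemma constant_bounds (R : realType) (m : nat) (eps C : R) :
  0 < eps -> 0 <= C -> exists2 kappa0 : R, 1 <= kappa0 &
  forall kappa, kappa0 <= kappa -> exists k : nat, [/\ (0 < k)%N,
    C * kappa ^+ m <= expR k%:R &
    1 + Num.sqrt (expR 1 * k%:R) <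
      (expR (m%:R - 2^-1) + eps) * Num.sqrt (ln kappa)].
Proof.
move=> eps0 C0.
have e0 : 0 < expR 1 :> R by exact: expR_gt0.
pose eta := eps ^+ 2 / (8 * expR 1).
have eta0 : 0 < eta by rewrite divr_gt0 ?exprn_gt0 ?mulr_gt0.
have C1 : 0 < C + 1 by rewrite ltr_wpDl.
have lC0 : 0 <= ln (C + 1) by rewrite ln_ge0// lerDr.
pose L0 := ln (C + 1) / eta + eta^-1 + 4 / eps ^+ 2 + 1.
have ieta0 : 0 < eta^-1 by rewrite invr_gt0.
have ieps0 : 0 < 4 / eps ^+ 2 by rewrite divr_gt0 ?exprn_gt0.
have lCe0 : 0 <= ln (C + 1) / eta by rewrite divr_ge0// ltW.
exists (expR L0) => [|kappa k0].
  by rewrite -expR0 ler_expR /L0; lra.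
have kappa0 : 0 < kappa by apply: lt_le_trans k0; exact: expR_gt0.
pose L := ln kappa; have kE : expR L = kappa by rewrite lnK.
have L0L : L0 <= L by rewrite -ler_expR kE.
have Lpos : 0 < L by rewrite (lt_le_trans _ L0L)// /L0; lra.
have H1 : ln (C + 1) <= eta * L.
  by rewrite mulrC -ler_pdivrMr// (le_trans _ L0L)// /L0; lra.
have H2 : 1 <= eta * L.
  by rewrite mulrC -ler_pdivrMr// mul1r (le_trans _ L0L)// /L0; lra.
have H3 : 4 < eps ^+ 2 * L.
  by rewrite mulrC -ltr_pdivrMr ?exprn_gt0// (lt_le_trans _ L0L)// /L0; lra.
have t0 : 0 <= (m%:R + eta) * L by rewrite mulr_ge0 ?ltW// ltr_wpDl.
have /andP[t1 t2] := truncn_itv t0.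
set k := (Num.truncn _).+1 in t2; exists k; split => //.
  apply: (@le_trans _ _ (expR (ln (C + 1) + m%:R * L))).
    rewrite expRD lnK// expRM_natl kE ler_wpM2r ?exprn_ge0 ?(ltW kappa0)//.
    by rewrite lerDl.
  rewrite ler_expR (le_trans _ (ltW t2))//; lra.
(* e^(2m - 2) >= 2m - 1 >= m when m >= 1 *)
have em : expR 1 * m%:R <= expR (m%:R - 2^-1) ^+ 2 :> R.
  rewrite -expRM_natl (_ : 2%:R * _ = 1 + (2 * m%:R - 2)); last by field.
  rewrite expRD ler_wpM2l ?(ltW e0)//.
  case: m {t0 t1 t2 k} => [|m]; first by rewrite expR_ge0.
  apply: le_trans (expR_ge1Dx _).
  have : 0 <= m%:R :> R by [].
  rewrite -natr1; lra.
pose a : R := expR (m%:R - 2^-1).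
have a0 : 0 < a by exact: expR_gt0.
have kL : k%:R <= (m%:R + 2 * eta) * L by rewrite /k -natr1; lra.
have ek : expR 1 * k%:R <= (a + eps / 2) ^+ 2 * L.
  apply: (@le_trans _ _ (expR 1 * ((m%:R + 2 * eta) * L))).
    by rewrite ler_wpM2l ?(ltW e0).
  rewrite mulrA ler_wpM2r ?(ltW Lpos)// mulrDr.
  have -> : expR 1 * (2 * eta) = (eps / 2) ^+ 2.
    by rewrite /eta; field; rewrite gt_eqF.
  have := mulr_ge0 (ltW a0) (ltW eps0); move: em; rewrite -/a; nra.
have sL : 1 < eps / 2 * Num.sqrt L.
  rewrite -[eps / 2]ger0_norm ?divr_ge0 ?(ltW eps0)//.
  rewrite -sqrtr_sqr -sqrtrM ?sqr_ge0// -[ltLHS]sqrtr1 ltr_sqrt.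
    rewrite expr_div_n; lra.
  by rewrite mulr_gt0 ?exprn_gt0 ?divr_gt0.
have : Num.sqrt (expR 1 * k%:R) <= (a + eps / 2) * Num.sqrt L.
  have ae : 0 <= a + eps / 2 by rewrite addr_ge0 ?divr_ge0 ?ltW.
  rewrite -[a + eps / 2]ger0_norm// -sqrtr_sqr -sqrtrM ?sqr_ge0//.
  exact: ler_wsqrtr.
rewrite -/a -/L; lra.
Qed.

Theorem mainTheorem4 (R : realType) (m : nat) (M : ptopologicalType)
    (SM : smooth_structure R M m) (g : riemannian_metric SM)
    (M_compact : compact [set: M]) (M_connected : connected [set: M])
    (eps : R) (eps_gt0 : 0 < eps) :
  exists kappa0 : R,
  forall (G : topologicalGroupCarrierType) (d : nat)
    (SG : smooth_structure R G d) (act : G -> M -> M) (o : M)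
    (mu : probability (borel M) R),
  isotropy_irreducible_space g SG act o ->
  invariant_measure act mu ->
  forall (E : set (M -> R)) (n : nat) (b : 'I_n -> M -> R)
    (sigma : probability (borel 'rV[R]_n) R) (phi : M -> M -> R) (s : R),
  conditionE mu act E ->
  orthonormal_basis mu E b ->
  uniform_on_sphere sigma ->
  evaluation_vectors mu E phi ->
  dilation_factor g mu b phi s ->
  let kappa := Num.sqrt n%:R * s in
  kappa0 <= kappa ->
  (sphere_mean sigma b (@supnorm R M) <
     ((expR (m%:R - 2^-1) + eps) * Num.sqrt (ln kappa))%:E)%E.
Proof.
have [C C0 net] := gradient_net g M_compact.
have [kappa0 kappa01 bounds] := constant_bounds m eps_gt0 C0.
exists kappa0 => G d SG act o mu iis mu_inv E n b sigma phi s EE bE sigmaU phiE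
  dil kappa kk.
have [k [k0 Ck strict]] := bounds kappa kk.
have [J [P [Jcard Pnet]]] := net kappa (le_trans kappa01 kk).
have n0 : (0 < n)%N.
  rewrite lt0n; apply/eqP => n0; subst n.
  have [u Eu u0] := E_nonzero EE; have [_ _ /(_ u Eu)[x ux]] := bE.
  by apply: u0; rewrite ux; apply/funext => p; rewrite /lincomb big_ord0.
have actP := iis_action iis; have act_trans := iis_transitive iis.
have act_cont x : continuous (act x).
  have [cact _] := iis_smooth iis => p.
  apply: (@continuous_comp _ _ _ (fun q => (x, q)) (fun z => act z.1 z.2)).
    by apply: cvg_pair; [exact: cvg_cst|exact: cvg_id].
  exact: cact.
apply: (@le_lt_trans _ _ (1 + Num.sqrt (expR 1 * k%:R))%:E); last first.
  by rewrite lte_fin.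
apply: (mean_max_le (a := fun j => basis_row b (P j)) sigmaU n0 k0).
- by move=> j; exact: (basis_row_norm M_compact actP act_cont act_trans mu_inv
    EE bE phiE).
- exact: le_trans Jcard Ck.
- move=> r; exact: (supnorm_lower_semicontinuous M_compact EE bE).
- move=> x; exact: (supnorm_ge0 M_compact EE bE).
move=> x Sx.
have du := sphere_gradient_le M_compact actP act_cont act_trans mu_inv
  EE bE phiE n0 dil Sx.
(* M is inhabited, hence so is the index set of the net. *)
have [j0 _] := Pnet _ du point.
have [j _ jmax] := @arg_maxP _ R J j0 xpredT
  (fun j => `|dot x (basis_row b (P j))|) isT.
exists j; apply: supnorm_le => p; have [i pi] := Pnet _ du p.
rewrite -[lincomb b x p](subrK (lincomb b x (P i))).
apply: (le_trans (ler_normD _ _)); apply: lerD => //.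
by rewrite lincomb_dot; exact: jmax.
Qed.
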